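(* For every $\varepsilon\in(0,1)$ there exists $C>0$ such that for every fixed $d\ge2$, the random graph $G\sim G(n,Cd\log d/n)$ contains, with probability tending to $1$ as $n\to\infty$, a $d$-rigid component with at least $(1-\varepsilon)n$ vertices.
   Context: $G(n,p)$ is the binomial random graph on $[n]$ with each pair an edge independently with probability $p$. A graph $H=(V,E)$ with at least $d+1$ vertices is $d$-rigid if there is an embedding $\mathbf p:V\to\mathbb R^d$ whose rigidity matrix (rows indexed by edges, $d$ columns per vertex, row of $\{u,v\}$ equal to $\mathbf p(u)-\mathbf p(v)$ at $u$, $\mathbf p(v)-\mathbf p(u)$ at $v$, zero elsewhere) has rank $d|V|-\binom{d+1}{2}$. A $d$-rigid component of $G$ is an induced subgraph $G[U]$ that is $d$-rigid and such that $G[U']$ is not $d$-rigid for any $U\subsetneq U'$. Logarithms are natural. *)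

(* Defs.v *)
From HB Require Import structures.
From mathcomp Require Import all_boot all_order all_algebra.
From mathcomp Require Import all_classical all_reals all_analysis.

Set Implicit Arguments.
Unset Strict Implicit.
Unset Printing Implicit Defensive.

Import Order.TTheory GRing.Theory Num.Theory.
Import numFieldNormedType.Exports.

Local Open Scope ring_scope.

(** Finite simple graphs on [V]: an edge is a two-element set of vertices. *)

Record sgraph (V : finType) := SGraph {
  edges : {set {set V}};
  edgesP : [forall e in edges, #|e| == 2%N]
}.

HB.instance Definition _ (V : finType) := [isSub for @edges V].
HB.instance Definition _ (V : finType) := [Finite of sgraph V by <:].

Section Induced.
Variables (V : finType) (G : sgraph V) (U : {set V}).

Definition induced_edges : {set {set {x : V | x \in U}}} :=
  [set e : {set {x : V | x \in U}} | [set val x | x in e] \in edges G].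

Lemma induced_edgesP : [forall e in induced_edges, #|e| == 2%N].
Proof.
apply/forall_inP => e; rewrite inE => eG.
by rewrite -(card_imset _ val_inj) (forall_inP (edgesP G) _ eG).
Qed.

Definition induced : sgraph {x : V | x \in U} := SGraph induced_edgesP.

End Induced.

Section Rigidity.
Variables (R : realType) (d : nat).

(** The block of the row of [e] at the vertex [w]. For [e = [set u; v]] the sum
    over [x in e] has one nonzero term, at the other endpoint of [e]; see
    [rigidity_block_edge] and [rigidity_block_out]. *)
Definition rigidity_block (V : finType) (p : V -> 'rV[R]_d)
    (e : {set V}) (w : V) : 'rV[R]_d :=
  if w \in e then \sum_(x in e) (p w - p x) else 0.

Lemma rigidity_block_edge (V : finType) (p : V -> 'rV[R]_d) (u v : V) :
  u != v ->
  rigidity_block p [set u; v] u = p u - p v /\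
  rigidity_block p [set u; v] v = p v - p u.
Proof.
move=> uv; rewrite /rigidity_block !inE !eqxx orbT /=; split.
  by rewrite big_setU1 ?inE //= big_set1 subrr add0r.
by rewrite big_setU1 ?inE //= big_set1 subrr addr0.
Qed.

Lemma rigidity_block_out (V : finType) (p : V -> 'rV[R]_d) (e : {set V}) (w : V) :
  w \notin e -> rigidity_block p e w = 0.
Proof. by rewrite /rigidity_block => /negbTE ->. Qed.

(** The [d] columns of the [j]-th vertex are [mxvec_index j k], [k < d]. *)
Definition rigidity_matrix (V : finType) (H : sgraph V) (p : V -> 'rV[R]_d) :
    'M[R]_(#|edges H|, #|V| * d) :=
  \matrix_(i < #|edges H|)
    mxvec (\matrix_(j < #|V|) rigidity_block p (enum_val i) (enum_val j)).

(** The subtraction in [nat] does not truncate when [d < #|V|]. *)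
Definition rigid (V : finType) (H : sgraph V) : Prop :=
  (d.+1 <= #|V|)%N /\
  exists p : V -> 'rV[R]_d,
    injective p /\ \rank (rigidity_matrix H p) = (d * #|V| - 'C(d.+1, 2))%N.

Definition rigid_component (V : finType) (G : sgraph V) (U : {set V}) : Prop :=
  rigid (induced G U) /\
  forall U' : {set V}, U \proper U' -> ~ rigid (induced G U').

End Rigidity.

(** [Gnp_weight p G] is the probability of [G] in the binomial model when
    [0 <= p <= 1]; it is left as a formal expression for other [p]. *)
Definition Gnp_weight (R : realType) (n : nat) (p : R) (G : sgraph 'I_n) : R :=
  \prod_(e : {set 'I_n} | #|e| == 2%N) (if e \in edges G then p else 1 - p).

Definition Gnp_prob (R : realType) (n : nat) (p : R)
    (A : sgraph 'I_n -> Prop) : R :=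
  \sum_(G : sgraph 'I_n | `[< A G >]) Gnp_weight p G.

(** The weights sum to one, so they form a probability when [0 <= p <= 1]. *)
Lemma Gnp_prob_total (R : realType) (n : nat) (p : R) :
  @Gnp_prob R n p (fun=> True) = 1.
Proof.
rewrite /Gnp_prob (eq_bigl xpredT) => [|G]; last by apply/asboolP.
pose F (e : {set 'I_n}) : R := if #|e| == 2%N then p else 0.
pose H (e : {set 'I_n}) : R := if #|e| == 2%N then 1 - p else 1.
have : \prod_(e : {set 'I_n}) (F e + H e) = 1.
  apply: big1 => e _; rewrite /F /H; case: ifP => _; first by rewrite addrC subrK.
  by rewrite add0r.
rewrite bigA_distr => <-.
rewrite [RHS](bigID (fun J : {set {set 'I_n}} => [forall e in J, #|e| == 2%N])) /=.
rewrite [X in _ = _ + X]big1 ?addr0; last first.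
  move=> J /forall_inPn[e eJ e2].
  by rewrite (bigD1 e) //= eJ /F (negbTE e2) mul0r.
have w (G : sgraph 'I_n) : Gnp_weight p G = \prod_e (if e \in edges G then F e else H e).
  rewrite /Gnp_weight big_mkcond; apply: eq_bigr => e _; rewrite /F /H.
  case: (boolP (#|e| == 2%N)) => // e2; case: ifP => // eG.
  by rewrite (forall_inP (edgesP G) _ eG) in e2.
under eq_bigr do rewrite w.
rewrite [RHS](reindex_omap (fun G : sgraph 'I_n => edges G) insub) /=.
  apply: eq_bigl => G. rewrite (edgesP G) /=.
  by rewrite (valK G) eqxx.
by move=> J JP; rewrite (insubT (fun J : {set {set 'I_n}} => [forall e in J, #|e| == 2%N]) JP).
Qed.

(* Main.v *)
(** Colour the vertices with [d] colours, as evenly as possible. If every colour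
    class [V_i] and every bipartite graph between [V_i] and [V_j] is connected,
    the graph is [d]-rigid: put the vertices of [V_i] on the [i]-th coordinate
    axis, at distinct positive heights; then the infinitesimal motions can be
    written down exactly, one parameter for each [i] and one for each [i < j].

    To find such a coloured subgraph, call [D] closed if every vertex of [D] has
    a colour [j] such that all its neighbours of colour [j] lie in [D]. Take [D]
    maximal among the closed sets of size at most [eps * n / (8 * d)]. If some
    colour pair were disconnected outside [D], the smaller side of the cut could
    be added to [D] (both sides cannot be large because any two disjoint sets of
    size [n / (16 * d)] are joined by an edge), giving a closed set of medium
    size. A union bound rules out medium closed sets: such a [D], with its choice
    of colours, forces about [#|D| * n / (4 * d)] non-edges, of probability
    [d ^ (- C * #|D| / 4)], which beats the [(O (d / eps)) ^ #|D|] choices of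
    sets and the [d ^ #|D|] choices of colours. *)

Require Import Defs.
From HB Require Import structures.
From mathcomp Require Import all_boot all_order all_algebra.
From mathcomp Require Import all_classical all_reals all_analysis.
From mathcomp Require Import zify ring lra.

Set Implicit Arguments.
Unset Strict Implicit.
Unset Printing Implicit Defensive.

Import Order.TTheory GRing.Theory Num.Theory.
Import numFieldNormedType.Exports.

Local Open Scope ring_scope.

(* Connectivity as absence of a nontrivial cut [P]: of [V_i] when [i = j], of the
   bipartite graph between [V_i] and [V_j] otherwise. *)
Definition color_connected (V : finType) (G : sgraph V) (d : nat) (c : V -> 'I_d) :=
  forall (i j : 'I_d) (P : pred V),
    (forall u v, c u = i -> c v = j -> [set u; v] \in edges G -> P u = P v) ->
    forall u v, c u \in [:: i; j] -> c v \in [:: i; j] -> P u = P v.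

(** * Rigidity of graphs with connected colour pairs *)

Section ColoredRigidity.
Variables (R : realType) (d : nat) (V : finType) (G : sgraph V) (c : V -> 'I_d).

(** Heights start at one: being distinct and nonzero, they separate points on the same axis and on
    different axes, and they can be divided by. *)
Definition scale (v : V) : R := (enum_rank v).+1%:R.

Definition axis_point (v : V) : 'rV[R]_d := scale v *: delta_mx 0 (c v).

Lemma scale_gt0 v : 0 < scale v. Proof. by rewrite ltr0n. Qed.

Lemma axis_pointE v k : axis_point v 0 k = if k == c v then scale v else 0.
Proof. by rewrite !mxE eqxx /=; case: eqP => _; rewrite ?mulr1 ?mulr0. Qed.

Lemma axis_point_inj : injective axis_point.
Proof.
move=> u v /rowP /(_ (c u)); rewrite !axis_pointE eqxx.
case: eqP => _; last by move=> s0; have := scale_gt0 u; rewrite s0 ltxx.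
by move/eqP; rewrite eqr_nat eqSS => /eqP/val_inj/enum_rank_inj.
Qed.

Lemma sum_axis_point (f : 'I_d -> R) v :
  \sum_k f k * axis_point v 0 k = f (c v) * scale v.
Proof.
rewrite (bigD1 (c v)) //= axis_pointE eqxx big1 ?addr0 // => k /negbTE kv.
by rewrite axis_pointE kv mulr0.
Qed.

Lemma mxvec_mul_tr (m n : nat) (A B : 'M[R]_(m, n)) :
  mxvec A *m (mxvec B)^T = (\sum_i \sum_k A i k * B i k)%:M.
Proof.
apply/rowP => z; rewrite ord1 !mxE eqxx mulr1n pair_bigA /=.
rewrite (reindex _ (curry_mxvec_bij _ _)) /=.
by apply: eq_bigr => -[i k] _; rewrite mxE !mxvecE.
Qed.

(** The row of an edge pairs with a motion to the inner product of the position difference and the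
    velocity difference. An axis point has one nonzero coordinate, so only the coordinates [c u] and
    [c v] survive. *)
Lemma rigidity_kerP (X : 'M[R]_(#|V|, d)) :
  reflect (forall u v, u != v -> [set u; v] \in edges G ->
             let x w k := X (enum_rank w) k in
             scale u * (x u (c u) - x v (c u)) = scale v * (x u (c v) - x v (c v)))
          (mxvec X *m (rigidity_matrix G axis_point)^T == 0).
Proof.
pose x w k := X (enum_rank w) k.
have rowE (e : {set V}) u v : u != v -> e = [set u; v] ->
    mxvec X *m (mxvec (\matrix_(j < #|V|) rigidity_block axis_point e (enum_val j)))^T =
    (scale u * (x u (c u) - x v (c u)) - scale v * (x u (c v) - x v (c v)))%:M.
  move=> uv ->; rewrite mxvec_mul_tr; congr (_ %:M).
  have [bu bv] := rigidity_block_edge axis_point uv.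
  rewrite (reindex (@enum_rank V)) /=; last by apply: onW_bij; apply: enum_rank_bij.
  rewrite (bigD1 u) //= (bigD1 v) 1?eq_sym //=.
  rewrite [X in _ + (_ + X)]big1 ?addr0; last first.
    move=> w /andP[wu wv]; apply: big1 => k _.
    by rewrite mxE enum_rankK rigidity_block_out ?mxE ?mulr0 // !inE negb_or wu.
  rewrite -big_split /= -[scale u * _]mulrC -[scale v * _]mulrC.
  pose f k := x u k - x v k.
  rewrite -(sum_axis_point f u) -(sum_axis_point f v) -sumrB.
  apply: eq_bigr => k _; rewrite /f /x !mxE !enum_rankK bu bv !mxE.
  by ring.
have entryE (e : 'I_#|edges G|) :
    (mxvec X *m (rigidity_matrix G axis_point)^T) 0 e =
    (mxvec X *m (mxvec (\matrix_(j < #|V|)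
       rigidity_block axis_point (enum_val e) (enum_val j)))^T) 0 0.
  by rewrite !mxE; apply: eq_bigr => l _; rewrite !mxE.
apply: (iffP eqP) => [X0 u v uv uvG|Xedge].
  apply/eqP; rewrite -subr_eq0; apply/eqP.
  have := entryE (enum_rank_in uvG [set u; v]).
  by rewrite X0 enum_rankK_in // (rowE _ u v) // !mxE eqxx.
apply/rowP => e; rewrite entryE [RHS]mxE.
have /cards2P[u [v [uv eE]]] : #|enum_val e| == 2%N.
  by apply: (forall_inP (edgesP G)); apply: enum_valP.
have uvG : [set u; v] \in edges G by rewrite -eE enum_valP.
by rewrite (rowE _ u v uv eE) mxE (Xedge u v uv uvG) subrr mul0rn.
Qed.

Lemma scale_inj : injective scale.
Proof. by move=> u v /eqP; rewrite eqr_nat eqSS => /eqP/val_inj/enum_rank_inj. Qed.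

(* Subsets of size one index the translations, subsets of size two the
   rotations. *)
Definition pairs : {set {set 'I_d}} :=
  [set A : {set 'I_d} | (#|A| == 1)%N || (#|A| == 2)%N].

Lemma card_pairs : #|pairs| = 'C(d.+1, 2).
Proof.
have e k : 'C(d, k) = #|[set A : {set 'I_d} | #|A| == k]|.
  by rewrite card_draws card_ord.
rewrite binS !e addnC -cardsUI.
rewrite [X in (_ + #|pred_of_set X|)%N](_ : _ = finset.set0) ?cards0 ?addn0.
  by apply: eq_card => A; rewrite !inE.
by apply/setP => A; rewrite !inE; case: eqP => // ->.
Qed.

Lemma pairs_set2 i k : [set i; k] \in pairs.
Proof. by rewrite inE cards2; case: (i == k). Qed.

Lemma set2_le_inj (i k i' k' : 'I_d) :
  (i <= k)%N -> (i' <= k')%N -> [set i; k] = [set i'; k'] -> i = i' /\ k = k'.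
Proof.
move=> ik ik' /setP E.
have := E i; have := E k; have := E i'; have := E k'.
rewrite !inE !eqxx ?orbT /=.
move=> /orP[]/eqP e1 /orP[]/eqP e2 /esym/orP[]/eqP e3 /esym/orP[]/eqP e4;
  by split; apply: val_inj => /=; subst; lia.
Qed.

Definition orient (i k : 'I_d) : R := (i < k)%N%:R - (k < i)%N%:R.

(** A singleton [A] gives a unit translation, the second term being killed by [orient]. A pair gives
    the infinitesimal rotation of its coordinate plane, with [orient] supplying the sign that an
    unordered pair lacks. *)
Definition flex (A : {set 'I_d}) : 'M[R]_(#|V|, d) :=
  \matrix_(j, k)
    ((A == [set k])%:R + scale (enum_val j) * orient (c (enum_val j)) k *
       (A == [set c (enum_val j); k])%:R).

Definition flexes : 'M[R]_(#|pairs|, #|V| * d) :=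
  \matrix_t mxvec (flex (enum_val t)).

Lemma orientC i k : orient i k = - orient k i.
Proof. by rewrite /orient opprB. Qed.

Lemma orient_id i : orient i i = 0.
Proof. by rewrite /orient subrr. Qed.

Lemma orient_neq0 i k : i != k -> orient i k != 0.
Proof.
move=> ik; rewrite /orient; case: ltngtP => /= [_|_|/val_inj e].
- by rewrite subr0 oner_neq0.
- by rewrite sub0r oppr_eq0 oner_neq0.
- by rewrite e eqxx in ik.
Qed.

(** Translations cancel in velocity differences. For a rotation, both sides of the edge equation are
    the product of the two heights with the same sign, by antisymmetry of [orient]. *)
Lemma flexes_ker : flexes *m (rigidity_matrix G axis_point)^T = 0.
Proof.
apply/row_matrixP => t; rewrite row_mul rowK row0; apply/eqP/rigidity_kerP.
move=> u v _ _ /=; rewrite !mxE !enum_rankK !orient_id (orientC (c u) (c v)).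
rewrite [[set c v; c u]]finset.setUC.
by ring.
Qed.

Hypothesis c_surj : forall i, exists v, c v = i.

(** Evaluate a vanishing combination at a vertex [v] and a coordinate [k]. Taking [c v = k] isolates
    the translation coefficient; then [c v != k] isolates a rotation coefficient. *)
Lemma flexes_free : row_free flexes.
Proof.
apply: inj_row_free => th th0.
pose S A := \sum_t th 0 t * (enum_val t == A)%:R.
have SE v k : S [set k] + scale v * orient (c v) k * S [set c v; k] = 0.
  have := congr1 (fun x : 'rV_(#|V| * d) => x 0 (mxvec_index (enum_rank v) k)) th0.
  rewrite !mxE => <-; rewrite /S big_distrr -big_split /=; apply: eq_bigr => t _.
  by rewrite mxE mxvecE mxE enum_rankK; ring.
have S1 k : S [set k] = 0.
  by have [v vk] := c_surj k; have := SE v k; rewrite vk orient_id mulr0 mul0r addr0.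
have S2 i k : i != k -> S [set i; k] = 0.
  have [v <-] := c_surj i => /orient_neq0 o0; have := SE v k.
  rewrite S1 add0r => /eqP; rewrite mulf_eq0 mulf_eq0 (negbTE o0) gt_eqF ?scale_gt0 //=.
  by move/eqP.
apply/rowP => t; rewrite [RHS]mxE.
have -> : th 0 t = S (enum_val t).
  rewrite /S (bigD1 t) //= eqxx mulr1 big1 ?addr0 // => t' tt'.
  by rewrite (inj_eq enum_val_inj) (negbTE tt') mulr0.
have := enum_valP t; rewrite inE => /orP[/cards1P[k ->]|/cards2P[i [k [ik ->]]]].
  exact: S1.
exact: S2.
Qed.

Hypothesis c_conn : color_connected G c.

Lemma edge_neq u v : [set u; v] \in edges G -> u != v.
Proof. by move/(forall_inP (edgesP G)); rewrite cards2; case: (u == v). Qed.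

(** Connectivity propagates zeros from the representatives: the conditions with [i = k] handle the
    coordinate of each vertex along its own axis, and those with [i < k] the motion between two
    classes. *)
Lemma ker_rep_eq0 (rep : 'I_d -> V) (X : 'M[R]_(#|V|, d)) :
  (forall i, c (rep i) = i) ->
  mxvec X *m (rigidity_matrix G axis_point)^T == 0 ->
  (forall i k : 'I_d, (i <= k)%N -> X (enum_rank (rep i)) k = 0) -> X = 0.
Proof.
move=> c_rep /rigidity_kerP Xedge Xrep.
pose x v k := X (enum_rank v) k.
(* Inside a class the edge equation factors as a difference of heights times a difference of own
   coordinates. Heights of distinct vertices differ, so no edge crosses the cut given by the zero
   set. *)
have own v : x v (c v) = 0.
  set i := c v; apply/eqP.
  rewrite (@c_conn i i (fun w => x w i == 0) _ v (rep i)) ?inE ?c_rep ?eqxx //=.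
    by rewrite /x Xrep.
  move=> u w cu cw uw; have := Xedge u w (edge_neq uw) uw.
  rewrite /= -!/(x _ _) cu cw => /eqP; rewrite -subr_eq0 -mulrBl mulf_eq0 subr_eq0.
  by rewrite (inj_eq scale_inj) (negbTE (edge_neq uw)) /= subr_eq0 => /eqP ->.
have other (i k : 'I_d) : (i < k)%N ->
    forall v, c v \in [:: i; k] -> (if c v == i then x v k else x v i) = 0.
  move=> ik v; rewrite !inE => cv.
  have ki : (k == i) = false by apply/eqP => e; rewrite e ltnn in ik.
  (* The edge equations say that [y] is constant along the edges joining [V_i]
     and [V_k]. *)
  pose y w := (if c w == i then x w k else - x w i) / scale w.
  suff /eqP : y v == 0.
    rewrite /y => /eqP; rewrite mulf_eq0 invr_eq0 (gt_eqF (scale_gt0 v)) orbF.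
    by case: ifP => _; rewrite ?oppr_eq0 => /eqP.
  rewrite (@c_conn i k (fun w => y w == 0) _ v (rep i)) ?inE ?c_rep ?eqxx //=.
    by rewrite /y c_rep eqxx /x Xrep ?mul0r // ltnW.
  move=> u w cu cw uw; have := Xedge u w (edge_neq uw) uw.
  rewrite /= -!/(x _ _) /y cu cw eqxx ki -{1}cu own -{2}cw own sub0r subr0 => e.
  congr (_ == 0); apply/eqP; rewrite eqr_div ?lt0r_neq0 ?scale_gt0 //.
  by rewrite [_ * scale w]mulrC -e mulrC.
apply/matrixP => j k; rewrite -[j]enum_valK [RHS]mxE -/(x _ _).
set v := enum_val j; case: (ltngtP (c v) k) => [lt|gt|/val_inj <-].
- by have := other _ _ lt v; rewrite inE eqxx; apply.
- have := other _ _ gt v; rewrite !inE eqxx orbT.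
  by case: eqP => [e|_]; [rewrite e ltnn in gt|apply].
- exact: own.
Qed.

(** The free flexes bound the kernel dimension from below by [#|pairs|]. Conversely, appending
    [#|pairs|] rows that pin the representatives leaves a trivial kernel. *)
Lemma rank_rigidity_matrix :
  \rank (rigidity_matrix G axis_point) = (d * #|V| - 'C(d.+1, 2))%N.
Proof.
set M := rigidity_matrix _ _; rewrite -card_pairs [(d * _)%N]mulnC.
have rM : (\rank M <= #|V| * d)%N by apply: rank_leq_col.
have le1 : (#|pairs| <= #|V| * d - \rank M)%N.
  rewrite -[X in (_ - X)%N]mxrank_tr -mxrank_ker -(eqP flexes_free).
  by apply: mxrankS; apply/sub_kermxP/flexes_ker.
suff le2 : (#|V| * d <= \rank M + #|pairs|)%N by lia.
have [rep c_rep] := choice c_surj.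
(* For [i <= k], the row of [[set i; k]] reads coordinate [k] of the velocity of [rep i]. *)
pose E : 'M[R]_(#|pairs|, #|V| * d) := \matrix_t mxvec (\matrix_(j, k)
  ((enum_val j == rep (c (enum_val j))) && (c (enum_val j) <= k)%N
   && (enum_val t == [set c (enum_val j); k]))%:R).
have free : row_free (col_mx M E)^T.
  apply: inj_row_free => x; rewrite tr_col_mx mul_mx_row => /eqP.
  rewrite -(vec_mxK x); move: (vec_mx x) => X; rewrite row_mx_eq0 => /andP[xM /eqP xE].
  rewrite (ker_rep_eq0 c_rep xM) ?linear0 // => i k ik.
  pose t := enum_rank_in (pairs_set2 i k) [set i; k].
  have tE : enum_val t = [set i; k] by rewrite enum_rankK_in ?pairs_set2.
  have := congr1 (fun y : 'rV_#|pairs| => y 0 t) xE; rewrite [RHS]mxE => <-.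
  transitivity ((mxvec X *m (row t E)^T) 0 0); last first.
    by rewrite !mxE; apply: eq_bigr => l _; rewrite !mxE.
  rewrite rowK mxvec_mul_tr [RHS]mxE.
  rewrite (bigD1 (enum_rank (rep i))) //= (bigD1 k) //=.
  rewrite mxE enum_rankK c_rep eqxx ik /= tE eqxx mulr1.
  rewrite [X in _ + X + _]big1 ?addr0 => [|k' kk']; last first.
    rewrite mxE enum_rankK c_rep eqxx /=.
    case: andP => [[ik' /eqP e]|_]; last by rewrite mulr0.
    by have [_ e'] := set2_le_inj ik ik' e; rewrite e' eqxx in kk'.
  rewrite big1 ?addr0 ?mulr1n // => j ji; apply: big1 => k' _.
  rewrite mxE.
  case: andP => [[/andP[/eqP jr ik'] /eqP e]|_]; last by rewrite mulr0.
  have [e' _] := set2_le_inj ik ik' e.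
  by rewrite e' -jr enum_valK eqxx in ji.
rewrite -[X in (X <= _)%N](eqP free) mxrank_tr -addsmxE.
apply: leq_trans (mxrank_adds_leqif _ _) _; rewrite leq_add2l; exact: rank_leq_row.
Qed.

Lemma color_connected_rigid : (d < #|V|)%N -> rigid R d G.
Proof.
move=> dV; split=> //; exists axis_point; split; first exact: axis_point_inj.
exact: rank_rigidity_matrix.
Qed.

End ColoredRigidity.

(** * A large subset with connected colour pairs *)

Section Core.
Variables (R : realType) (d : nat) (V : finType) (G : sgraph V) (c : V -> 'I_d).

Definition color_closed (D : {set V}) :=
  [forall v in D, exists j, forall w,
     (w \notin D) && (c w == j) ==> ([set v; w] \notin edges G)].

(** In the application [x] is [n / (16 * d)] and [y] is [eps * n / (8 * d)]; medium sizes run from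
    [y] to [y + 2 * x]. *)
Variables x y : R.
Hypothesis y_ge0 : 0 <= y.
Hypothesis class_large : forall j, y + 2 * x <= #|[set v | c v == j]|%:R.
Hypothesis large_joined : forall A B : {set V}, [disjoint A & B] ->
  x <= #|A|%:R -> x <= #|B|%:R ->
  exists a b, [/\ a \in A, b \in B & [set a; b] \in edges G].
Hypothesis no_medium_closed : forall D : {set V},
  y < #|D|%:R -> #|D|%:R <= y + 2 * x -> ~~ color_closed D.

Section MaximalClosed.
Variable D : {set V}.
Hypothesis D_closed : color_closed D.
Hypothesis D_small : #|D|%:R <= y.
Hypothesis D_max : forall D', color_closed D' -> #|D'|%:R <= y -> (#|D'| <= #|D|)%N.

(** If [S] were smaller, [D :|: S] would be closed and either of size at most [y], against
    maximality of [D], or medium. *)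
Lemma isolated_part_large (i j : 'I_d) (S : {set V}) s :
  s \in S -> [disjoint S & D] -> {in S, forall v, c v \in [:: i; j]} ->
  (forall u v, u \in S -> v \notin D -> v \notin S ->
    (c u == i) && (c v == j) || (c u == j) && (c v == i) ->
    [set u; v] \notin edges G) ->
  2 * x <= #|S|%:R.
Proof.
move=> sS SD Sij Siso; rewrite leNgt; apply/negP => Sx.
have DS_closed : color_closed (D :|: S).
  apply/forall_inP => v; rewrite inE => /orP[vD|vS].
    have /existsP[k /forallP vk] := forall_inP D_closed _ vD.
    apply/existsP; exists k; apply/forallP => w; apply/implyP.
    rewrite inE negb_or -andbA => /and3P[wD _ wk].
    by apply: (implyP (vk w)); rewrite wD.
  have /orP vij : (c v == i) || (c v == j) by have := Sij v vS; rewrite !inE.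
  (* A vertex of [S] takes as witness the other colour of the pair, which is its own colour when
     [i = j]. *)
  apply/existsP; exists (if c v == i then j else i).
  apply/forallP => w; apply/implyP; rewrite inE negb_or => /andP[/andP[wD wS] wc].
  by apply: Siso => //; case: (c v == i) wc vij => /= -> // [//|->].
have DS_card : #|D :|: S| = (#|D| + #|S|)%N.
  rewrite cardsU (_ : D :&: S = finset.set0) ?cards0 ?subn0 //.
  by apply/eqP; rewrite setI_eq0 disjoint_sym.
have S_gt0 : (0 < #|S|)%N by apply/card_gt0P; exists s.
have [DSy|yDS] := leP (#|D :|: S|%:R : R) y.
  by have := D_max DS_closed DSy; rewrite DS_card; lia.
apply: (negP (no_medium_closed yDS _)) => //; rewrite DS_card natrD.
by rewrite lerD // ltW.
Qed.

Lemma maximal_closed_connected :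
  color_connected (Defs.induced G (~: D)) (fun v => c (val v)).
Proof.
move=> i j P Pedge u v cu cv; apply/eqP; apply: contraT => Puv.
pose T b :=
  [set val w | w : {w | w \in ~: D} & (c (val w) \in [:: i; j]) && (P w == b)].
have TP b w :
    reflect (exists wD : w \in ~: D, c w \in [:: i; j] /\ P (Sub w wD) = b)
            (w \in T b).
  apply: (iffP imsetP) => [[[w' wD]]|[wD [wc wb]]].
    by rewrite inE /= => /andP[wc /eqP wb] ->; exists wD.
  by exists (Sub w wD) => //; rewrite inE /= wc; apply/eqP.
have TD b : [disjoint T b & D].
  rewrite disjoint_subset; apply/fintype.subsetP => w /TP[wD _].
  by rewrite inE in wD.
have Tiso b u' v' : u' \in T b -> v' \in T (~~ b) ->
    (c u' == i) && (c v' == j) || (c u' == j) && (c v' == i) ->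
    [set u'; v'] \notin edges G.
  move=> /TP[uD [_ ub]] /TP[vD [_ vb]] cuv; apply/negP => uvG.
  have e w1 w2 : [set val w1; val w2] \in edges G ->
      [set w1; w2] \in edges (Defs.induced G (~: D)).
    by rewrite inE imsetU1 imset_set1.
  have : P (Sub u' uD) = P (Sub v' vD).
    case/orP: cuv => /andP[/eqP cu' /eqP cv'].
      exact: Pedge (e (Sub u' uD) (Sub v' vD) uvG).
    rewrite finset.setUC in uvG.
    by symmetry; apply: Pedge (e (Sub v' vD) (Sub u' uD) uvG).
  by rewrite ub vb; case: (b).
(* Both sides of the cut are nonempty because [P] separates [u] from [v]. *)
have T_large b : 2 * x <= #|T b|%:R.
  have [s sT] : exists s, s \in T b.
    have [wb|wb] := eqVneq (P u) b.
      exists (val u); apply/TP; exists (valP u); split => //.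
      by rewrite -wb; congr P; apply: val_inj.
    exists (val v); apply/TP; exists (valP v); split => //.
    have -> : Sub (val v) (valP v) = v by apply: val_inj.
    by move: wb Puv; case: (P u) (P v) b => [] [] [].
  apply: (isolated_part_large sT (TD b) (i := i) (j := j)).
    by move=> w /TP[_ [? _]].
  move=> u' v' uT vD vT cuv; apply: (Tiso b) => //; apply/TP.
  have vD' : v' \in ~: D by rewrite inE.
  have cv' : c v' \in [:: i; j].
    by rewrite !inE; case/orP: cuv => /andP[_ ->]; rewrite ?orbT.
  exists vD'; split => //; apply/eqP; apply: contraT => vb; case/negP: vT; apply/TP.
  by exists vD'; split => //; move: vb; case: (P _) (b) => [] [].
pose part b k := [set w in T b | c w == k].
have part_le b : (#|T b| <= #|part b i| + #|part b j|)%N.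
  apply: leq_trans (leq_card_setU _ _); apply/subset_leq_card/fintype.subsetP => w wT.
  by rewrite !inE wT /=; case/TP: wT => _ [+ _]; rewrite !inE.
have class_le k : k \in [:: i; j] ->
    (#|[set w | c w == k]| <= #|D| + (#|part true k| + #|part false k|))%N.
  move=> kij; apply: leq_trans (leq_add (leqnn _) (leq_card_setU _ _)).
  apply: leq_trans (leq_card_setU _ _); apply/subset_leq_card/fintype.subsetP => w.
  rewrite !inE => /eqP wk; rewrite wk eqxx !andbT; case: (boolP (w \in D)) => //= wD.
  have wD' : w \in ~: D by rewrite inE.
  case E : (P (Sub w wD')); apply/orP; [left|right]; apply/TP; exists wD';
    by rewrite wk.
have cross b k l : (k, l) \in [:: (i, j); (j, i)] ->
    ~~ ((x <= #|part b k|%:R) && (x <= #|part (~~ b) l|%:R)).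
  move=> kl; apply/negP => /andP[bk bl].
  have dis : [disjoint part b k & part (~~ b) l].
    rewrite disjoint_subset; apply/fintype.subsetP => w.
    rewrite !inE => /andP[/TP[wD [_ wb]] _].
    apply/negP => /andP[/TP[wD' [_ wb']] _].
    by move: wb'; rewrite (bool_irrelevance wD' wD) wb; case: (b).
  have [a [a' [+ + aG]]] := large_joined dis bk bl.
  rewrite !inE => /andP[aT /eqP ak] /andP[aT' /eqP al].
  apply: (negP (Tiso _ _ _ aT aT' _)) => //; rewrite ak al.
  by move: kl; rewrite !inE => /orP[]/eqP[-> ->]; rewrite !eqxx ?orbT.
have ci := class_large i; have cj := class_large j.
have := class_le i; have := class_le j.
rewrite !inE !eqxx orbT => /(_ isT) cj' /(_ isT) ci'.
have ij : (i, j) \in [:: (i, j); (j, i)] by rewrite inE eqxx.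
have ji : (j, i) \in [:: (i, j); (j, i)] by rewrite !inE eqxx orbT.
have t1 := part_le true; have t2 := part_le false.
have l1 := T_large true; have l2 := T_large false.
move: (cross true _ _ ij) (cross true _ _ ji) => /=.
move: cj' ci' t1 t2; rewrite -!(ler_nat R) !natrD.
rewrite !negb_and -!ltNge.
(* Each use of [cross] yields a part smaller than [x]. The two small parts lie either on the same
   side, contradicting [T_large], or in the same colour, contradicting [class_large]. *)
move=> cj' ci' t1 t2 /orP[] a1 /orP[] a2; suff : False by [].
all: move: (D_small) t1 t2 l1 l2 ci cj ci' cj' a1 a2; lra.
Qed.

End MaximalClosed.

Lemma exists_color_connected :
  exists D : {set V}, #|D|%:R <= y /\
    color_connected (Defs.induced G (~: D)) (fun v => c (val v)).
Proof.
pose ok (D : {set V}) := color_closed D && (#|D|%:R <= y).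
have ok0 : ok finset.set0.
  by rewrite /ok cards0 y_ge0 andbT; apply/forall_inP => v; rewrite inE.
case: (@arg_maxnP _ finset.set0 ok (fun D => #|D|) ok0) => D /andP[Dcl Dy] Dmax.
exists D; split=> //; apply: maximal_closed_connected => // D' Dcl' Dy'.
by apply: Dmax; rewrite /ok Dcl'.
Qed.

End Core.

(** * Union bounds in the binomial random graph *)

Section RandomGraph.
Variables (R : realType) (n : nat) (p : R).
Hypothesis p01 : 0 <= p <= 1.

Lemma Gnp_weight_ge0 (G : sgraph 'I_n) : 0 <= Gnp_weight p G.
Proof.
have [p0 p1] := andP p01.
by apply: prodr_ge0 => e _; case: ifP => _; rewrite ?subr_ge0.
Qed.

Lemma Gnp_prob_indicator (A : sgraph 'I_n -> Prop) :
  Gnp_prob p A = \sum_G (if `[< A G >] then Gnp_weight p G else 0).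
Proof. by rewrite /Gnp_prob big_mkcond. Qed.

Lemma Gnp_prob_le (A B : sgraph 'I_n -> Prop) :
  (forall G, A G -> B G) -> Gnp_prob p A <= Gnp_prob p B.
Proof.
move=> AB; rewrite !Gnp_prob_indicator; apply: ler_sum => G _.
case: asboolP => [/AB BG|_]; first by rewrite asboolT.
by case: ifP => // _; apply: Gnp_weight_ge0.
Qed.

Lemma Gnp_prob_le1 (A : sgraph 'I_n -> Prop) : Gnp_prob p A <= 1.
Proof. by rewrite -(Gnp_prob_total n p); apply: Gnp_prob_le. Qed.

Lemma Gnp_prob_union (T : finType) (Q : pred T) (A : T -> sgraph 'I_n -> Prop) :
  Gnp_prob p (fun G => exists2 x, Q x & A x G) <= \sum_(x | Q x) Gnp_prob p (A x).
Proof.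
rewrite Gnp_prob_indicator; under [X in _ <= X]eq_bigr do rewrite Gnp_prob_indicator.
rewrite exchange_big; apply: ler_sum => G _.
have w0 x : 0 <= (if `[< A x G >] then Gnp_weight p G else 0).
  by case: ifP => // _; apply: Gnp_weight_ge0.
case: asboolP => [[x Qx AG]|_]; last by apply: sumr_ge0.
by rewrite (bigD1 x) //= asboolT // lerDl; apply: sumr_ge0.
Qed.

Lemma Gnp_prob_ge (A B C : sgraph 'I_n -> Prop) :
  (forall G, ~ B G -> ~ C G -> A G) ->
  1 - Gnp_prob p B - Gnp_prob p C <= Gnp_prob p A.
Proof.
move=> ABC; rewrite !lerBlDr -(Gnp_prob_total n p) !Gnp_prob_indicator -!big_split.
apply: ler_sum => G _ /=.
have w0 := Gnp_weight_ge0 G; rewrite asboolT //.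
case: (asboolP (A G)) => [_|nA].
  by rewrite -addrA lerDl addr_ge0 //; case: ifP.
case: (asboolP (B G)) => [_|nB]; last case: (asboolP (C G)) => [_|nC].
- by rewrite lerDr add0r; case: ifP.
- by rewrite add0r addr0.
- by have := ABC _ nB nC.
Qed.

(** Expand the product of [F e + H e] over all sets [J] of chosen [e]: the terms with [J] a graph
    avoiding [N] are the weights, and any other [J] contains some [e] with [F e = 0]. *)
Lemma Gnp_prob_avoid (N : {set {set 'I_n}}) :
  (forall e, e \in N -> #|e| = 2%N) ->
  Gnp_prob p (fun G : sgraph 'I_n => [disjoint edges G & N]) = (1 - p) ^+ #|N|.
Proof.
move=> N2.
pose F (e : {set 'I_n}) : R := if (#|e| == 2%N) && (e \notin N) then p else 0.
pose H (e : {set 'I_n}) : R := if #|e| == 2%N then 1 - p else 1.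
transitivity (\prod_(e : {set 'I_n}) (F e + H e)); last first.
  rewrite (bigID (mem N)) /= [X in _ * X]big1 ?mulr1 => [|e eN].
    rewrite -prodr_const; apply: eq_bigr => e eN.
    by rewrite /F /H N2 //= eN add0r.
  rewrite /F /H eN andbT; case: ifP => _; first by rewrite addrC subrK.
  by rewrite add0r.
rewrite bigA_distr.
rewrite [RHS](bigID (fun J : {set {set 'I_n}} =>
  [forall e in J, #|e| == 2%N] && [disjoint J & N])) /=.
rewrite [X in _ = _ + X]big1 ?addr0; last first.
  move=> J; rewrite negb_and => /orP[/forall_inPn[e eJ e2]|/pred0Pn[e /= /andP[eJ eN]]].
    by rewrite (bigD1 e) //= eJ /F (negbTE e2) mul0r.
  by rewrite (bigD1 e) //= eJ /F eN andbF mul0r.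
have w (G : sgraph 'I_n) : [disjoint edges G & N] ->
    Gnp_weight p G = \prod_e (if e \in edges G then F e else H e).
  move=> GN; rewrite /Gnp_weight big_mkcond; apply: eq_bigr => e _; rewrite /F /H.
  case: (boolP (#|e| == 2%N)) => //= e2; case: ifP => // eG.
    by rewrite (disjointFr GN eG).
  by rewrite (forall_inP (edgesP G) _ eG) in e2.
rewrite [RHS](reindex_omap (fun G : sgraph 'I_n => edges G) insub) /=.
  apply: eq_big => [G|G /asboolP /w //]; rewrite (edgesP G) /= (valK G) eqxx andbT.
  by apply/asboolP/idP.
move=> J /andP[JP _].
by rewrite (insubT (fun J : {set {set 'I_n}} => [forall e in J, #|e| == 2%N]) JP).
Qed.

(** Since [D] separates the two coordinates, distinct elements of [X] give distinct edges; then
    [1 - p <= expR (- p)]. *)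
Lemma Gnp_prob_avoid_cut (D : {set 'I_n}) (X : {set 'I_n * 'I_n}) :
  (forall x, x \in X -> x.1 \in D /\ x.2 \notin D) ->
  Gnp_prob p (fun G : sgraph 'I_n =>
    forall x, x \in X -> [set x.1; x.2] \notin edges G) <= expR (- (p * #|X|%:R)).
Proof.
move=> XD; pose pair (x : 'I_n * 'I_n) := [set x.1; x.2].
have pair_inj : {in X &, injective pair}.
  move=> [a b] [a' b'] /XD/=[aD bD] /XD/=[aD' bD'] E.
  have ab u v : u \in D -> v \notin D -> (u == v) = false.
    by move=> uD vD; apply/eqP => uv; rewrite uv (negbTE vD) in uD.
  have := congr1 (fun S : {set 'I_n} => a \in S) E.
  have := congr1 (fun S : {set 'I_n} => b \in S) E.
  rewrite /pair !inE !eqxx orbT /= => /esym + /esym.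
  rewrite (ab a b') // orbF [b == a']eq_sym (ab a' b) //= => /eqP -> /eqP ->.
  by [].
have N2 e : e \in [set pair x | x in X] -> #|e| = 2%N.
  move=> /imsetP[x /XD[x1 x2] ->]; rewrite cards2; case: eqP => // e12.
  by rewrite -e12 x1 in x2.
have -> : - (p * #|X|%:R) = #|X|%:R * (- p) by rewrite mulrN mulrC.
rewrite expRM_natl -(card_in_imset pair_inj).
apply: le_trans (_ : (1 - p) ^+ #|[set pair x | x in X]| <= _).
  rewrite -(Gnp_prob_avoid N2); apply: Gnp_prob_le => G GX.
  rewrite disjoint_sym disjoint_subset; apply/fintype.subsetP => e /imsetP[x xX ->].
  by rewrite inE; apply: GX.
have [p0 p1] := andP p01.
by rewrite lerXn2r ?nnegrE ?subr_ge0 ?expR_ge0 ?expR_ge1Dx.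
Qed.

End RandomGraph.

(* Each term is multiplied by [expR (2 * (#|D| - dl * n)) >= 1], which turns the
   tail into a full binomial sum. *)
Lemma sum_large_sets (R : realType) (n : nat) (r dl : R) :
  0 <= r -> expR 2 * r <= dl ->
  \sum_(D : {set 'I_n} | dl * n%:R <= #|D|%:R) r ^+ #|D| <= expR (- dl) ^+ n.
Proof.
move=> r0 rdl.
have q0 : 0 <= expR 2 * r by rewrite mulr_ge0 ?expR_ge0.
apply: (@le_trans _ _ (\sum_(D : {set 'I_n})
  (expR 2 * r) ^+ #|D| * expR (- (2 * dl)) ^+ n)).
  rewrite big_mkcond; apply: ler_sum => D _; case: ifP => [Dl|_]; last first.
    by rewrite mulr_ge0 ?exprn_ge0 ?expR_ge0.
  rewrite exprMn mulrAC ler_peMl ?exprn_ge0 // -!expRM_natl -expRD.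
  rewrite -[leLHS]expR0 ler_expR; lra.
rewrite -mulr_suml.
have -> : \sum_(D : {set 'I_n}) (expR 2 * r) ^+ #|D| = (expR 2 * r + 1) ^+ n.
  transitivity (\prod_(i < n) (expR 2 * r + 1)); last by rewrite prodr_const card_ord.
  by rewrite bigA_distr; apply: eq_bigr => D _; rewrite -prodr_const big_mkcond.
(* It remains to compare the bases, by [1 + expR 2 * r <= 1 + dl <= expR dl]. *)
rewrite -exprMn lerXn2r ?nnegrE ?expR_ge0 ?mulr_ge0 ?addr_ge0 ?expR_ge0 //.
have -> : - dl = dl + - (2 * dl) by ring.
rewrite expRD ler_pM2r ?expR_gt0 // addrC.
by apply: le_trans (expR_ge1Dx _); rewrite lerD2l.
Qed.

(** * Probabilities of the two bad events *)

Definition unjoined_pair (R : realType) (V : finType) (x : R) (G : sgraph V) :=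
  exists2 S : {set V} * {set V},
    [&& [disjoint S.1 & S.2], x <= #|S.1|%:R & x <= #|S.2|%:R] &
    forall u, u \in finset.setX S.1 S.2 -> [set u.1; u.2] \notin edges G.

Definition medium_closed (R : realType) (V : finType) (d : nat) (c : V -> 'I_d)
    (y z : R) (G : sgraph V) :=
  exists2 D : {set V}, y <= #|D|%:R <= z & color_closed G c D.

(** For sizes [a, b >= x] one has [a * b >= (a + b) * x / 2], so the sum over pairs of sets is at
    most a product of two tails, each at most [t <= 1]. *)
Lemma Gnp_prob_unjoined (R : realType) (n : nat) (p be : R) :
  0 <= p <= 1 -> 0 <= be -> expR 2 * expR (- (p * (be * n%:R) / 2)) <= be ->
  Gnp_prob p (@unjoined_pair R 'I_n (be * n%:R)) <= expR (- be) ^+ n.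
Proof.
move=> p01 be0 rbe; have [p0 p1] := andP p01.
set r := expR (- _) in rbe; set t := expR (- be) ^+ n.
have r0 : 0 <= r by apply: expR_ge0.
apply: (le_trans (Gnp_prob_union p01 _ _)).
have t01 : 0 <= t <= 1.
  rewrite exprn_ge0 ?expR_ge0 ?exprn_ile1 ?expR_ge0 //.
  by rewrite -[leRHS]expR0 ler_expR oppr_le0.
apply: (@le_trans _ _ (t * t)); last by have [t0 t1] := andP t01; rewrite ler_piMl.
have tail := sum_large_sets n r0 rbe.
have tail0 : 0 <= \sum_(D : {set 'I_n} | be * n%:R <= #|D|%:R) r ^+ #|D|.
  by apply: sumr_ge0 => D _; apply: exprn_ge0.
apply: le_trans (ler_pM tail0 tail0 tail tail).
rewrite big_distrlr pair_big /= big_mkcond [X in _ <= X]big_mkcond.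
apply: ler_sum => -[A B] _ /=; case: ifP => [/and3P[AB Ax Bx]|_]; last first.
  by case: ifP => // _; rewrite mulr_ge0 ?exprn_ge0.
rewrite Ax Bx /= -exprD -expRM_natl.
apply: le_trans (Gnp_prob_avoid_cut p01 (D := A) _) _ => [[a b]|].
  by rewrite inE /= => /andP[aA bB]; rewrite (disjointFl AB bB).
rewrite cardsX ler_expR mulrN lerN2 !natrM natrD.
move: (#|A|%:R) (#|B|%:R) Ax Bx => a b ax bx.
have -> : (a + b) * (p * (be * n%:R) / 2) = p * ((a + b) * (be * n%:R) / 2) by ring.
apply: ler_wpM2l => //.
have x0 : 0 <= be * n%:R by rewrite mulr_ge0.
move: (be * n%:R) ax bx x0 => x ax bx x0; nra.
Qed.

(** Union bound over [D] and a witness colour for each of its vertices. As [D] covers at most [z]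
    vertices of a class, each vertex of [D] forces at least [m] non-edges. *)
Lemma Gnp_prob_medium_closed (R : realType) (n d : nat) (c : 'I_n -> 'I_d)
    (p dl z m : R) :
  0 <= p <= 1 -> (0 < d)%N ->
  (forall j, z + m <= #|[set v | c v == j]|%:R) ->
  expR 2 * (d%:R * expR (- (p * m))) <= dl ->
  Gnp_prob p (medium_closed c (dl * n%:R) z) <= expR (- dl) ^+ n.
Proof.
move=> p01 d0 class rdl; have [p0 p1] := andP p01.
pose j0 := Ordinal d0.
pose Q (x : {set 'I_n} * {ffun 'I_n -> 'I_d}) :=
  (dl * n%:R <= #|x.1|%:R <= z) && (x.2 \in pffun_on j0 (mem x.1) predT).
pose X (x : {set 'I_n} * {ffun 'I_n -> 'I_d}) : {set 'I_n * 'I_n} :=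
  [set u | (u.1 \in x.1) && ((u.2 \notin x.1) && (c u.2 == x.2 u.1))].
pose A x (G : sgraph 'I_n) := forall u, u \in X x -> [set u.1; u.2] \notin edges G.
apply: (@le_trans _ _ (Gnp_prob p (fun G => exists2 x, Q x & A x G))).
  apply: (Gnp_prob_le p01) => G [D Dz /forall_inP Dcl].
  pose ok v j := [forall w, (w \notin D) && (c w == j) ==> ([set v; w] \notin edges G)].
  (* Fixing the value [j0] outside [D] leaves only [d ^ #|D|] functions to count. Inside [D] the
     default is never reached, because [D] is closed. *)
  pose f := [ffun v => if v \in D then odflt j0 [pick j | ok v j] else j0].
  exists (D, f); rewrite /Q /A /X /= ?Dz /=.
    apply/pffun_onP; split=> //; apply/supportP => v vD.
    by rewrite ffunE (negbTE vD).
  move=> [v w]; rewrite inE /= => /and3P[vD wD]; rewrite ffunE vD.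
  case: pickP => [j /forallP/(_ w)/implyP vj /= wj|nok]; first by apply: vj; rewrite wD.
  by have /existsP[j vj] := Dcl v vD; have := nok j; rewrite /ok vj.
apply: (le_trans (Gnp_prob_union p01 _ _)).
have r0 : 0 <= d%:R * expR (- (p * m)) by rewrite mulr_ge0 ?expR_ge0.
apply: le_trans (sum_large_sets n r0 rdl).
rewrite -(pair_big_dep (fun D : {set 'I_n} => dl * n%:R <= #|D|%:R <= z)
  (fun (D : {set 'I_n}) f => f \in pffun_on j0 (mem D) predT)
  (fun D f => Gnp_prob p (A (D, f)))) /=.
rewrite big_mkcond [X in _ <= X]big_mkcond; apply: ler_sum => D _.
case: ifP => [/andP[-> Dz]|_]; last by case: ifP => // _; rewrite exprn_ge0.
apply: (@le_trans _ _ (\sum_(f in pffun_on j0 (mem D) predT) expR (- (p * m)) ^+ #|D|)).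
  apply: ler_sum => f _; apply: le_trans (Gnp_prob_avoid_cut p01 (D := D) _) _.
    by move=> [v w]; rewrite inE /= => /and3P[].
  rewrite -expRM_natl ler_expR mulrN lerN2 mulrCA; apply: ler_wpM2l => //.
  rewrite /X -sum1dep_card -(pair_big_dep (mem D)
    (fun v w => (w \notin D) && (c w == f v)) (fun _ _ => 1%N)) /=.
  rewrite natr_sum mulr_natl -sumr_const; apply: ler_sum => v _.
  rewrite sum1dep_card -(lerD2l z); apply: le_trans (class (f v)) _.
  apply: (@le_trans _ _ (#|D| + #|[set w | (w \notin D) && (c w == f v)]|)%N%:R).
    rewrite ler_nat; apply: leq_trans (leq_card_setU _ _).
    apply/subset_leq_card/fintype.subsetP => w; rewrite !inE => ->.
    by rewrite andbT orbN.
  by rewrite natrD lerD2r.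
by rewrite sumr_const card_pffun_on cardT size_enum_ord exprMn -natrX mulr_natl.
Qed.

(** * From pseudorandom graphs to a giant rigid component, with the choice of constants *)

(** A rigid vertex set of largest cardinality is inclusion-maximal; it need not contain [U0]. *)
Lemma rigid_sub_component (R : realType) (d : nat) (V : finType) (G : sgraph V)
    (U0 : {set V}) :
  rigid R d (Defs.induced G U0) ->
  exists U, rigid_component R d G U /\ (#|U0| <= #|U|)%N.
Proof.
move=> /asboolP U0r.
case: (@arg_maxnP _ U0 (fun U => `[< rigid R d (Defs.induced G U) >])
  (fun U => #|U|) U0r) => U /asboolP Ur Umax.
exists U; split; last exact: Umax.
split=> // U' /proper_card UU' /asboolP /Umax U'U.
by move: UU'; rewrite ltnNge => /negP; apply.
Qed.

(** With [q = n %/ d >= 1], the class contains the [q] numbers [k * d + j], and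
    [n < (q + 1) * d <= 2 * q * d]. *)
Lemma card_residue_class (n d : nat) (d0 : (0 < d)%N) (j : 'I_d) :
  (2 * d <= n)%N ->
  (n <= 2 * d * #|[set v : 'I_n | Ordinal (ltn_pmod v d0) == j]|)%N.
Proof.
move=> dn.
have kP (k : 'I_(n %/ d)) : (k * d + j < n)%N.
  have := ltn_ord k; have := ltn_ord j; have := leq_trunc_div n d; nia.
have inj : injective (fun k => Ordinal (kP k)).
  move=> k k' /(congr1 val) /= /addIn /eqP; rewrite eqn_pmul2r // => /eqP.
  exact: val_inj.
have : (n %/ d <= #|[set v : 'I_n | Ordinal (ltn_pmod v d0) == j]|)%N.
  rewrite -[X in (X <= _)%N]card_ord -cardsT -(card_imset _ inj).
  apply/subset_leq_card/fintype.subsetP => v /imsetP[k _ ->]; rewrite inE.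
  by apply/eqP/val_inj; rewrite /= modnMDl modn_small.
have := divn_eq n d; have := ltn_pmod n d0; nia.
Qed.

(** Dividing by [ln 2 <= ln d] lets a factor independent of [d] absorb the constant
    [16 * expR 2 / eps] for every [d >= 2]. *)
Lemma expR_log_decay (R : realType) (eps : R) (d : nat) :
  0 < eps -> eps < 1 -> (2 <= d)%N ->
  expR (- ((1 + ln (16 * expR 2 / eps) / ln 2) * ln d%:R)) <=
  eps / (16 * expR 2 * d%:R).
Proof.
move=> e0 e1 d2; have d0 : 0 < d%:R :> R by rewrite ltr0n; lia.
have E1 : 1 <= expR 2 :> R by rewrite -[leLHS]expR0 ler_expR.
have q0 : 0 < 16 * expR 2 / eps by rewrite divr_gt0 ?mulr_gt0 ?expR_gt0.
have K0 : 0 <= ln (16 * expR 2 / eps).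
  by rewrite ln_ge0 // ler_pdivlMr // mul1r; lra.
have l2 : 0 < ln 2 :> R by rewrite ln_gt0 // ltr1n.
have ld : ln 2 <= ln d%:R :> R by rewrite ler_ln ?posrE // ler_nat.
set K := ln (16 * expR 2 / eps) in K0 *.
apply: (@le_trans _ _ (expR (- (ln d%:R + K)))).
  rewrite ler_expR lerN2 mulrDl mul1r lerD2l mulrAC ler_pdivlMr //.
  exact: ler_wpM2l.
rewrite expRN expRD !lnK ?posrE // le_eqVlt; apply/orP; left; apply/eqP.
by field; rewrite !gt_eqF ?expR_gt0.
Qed.

Lemma rigid_of_pseudorandom (R : realType) (n d : nat) (c : 'I_n -> 'I_d)
    (G : sgraph 'I_n) (x y : R) :
  0 <= y -> 0 < x -> (forall j, y + 2 * x <= #|[set v | c v == j]|%:R) ->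
  d%:R + y < n%:R ->
  ~ unjoined_pair x G -> ~ medium_closed c y (y + 2 * x) G ->
  exists U, rigid_component R d G U /\ n%:R - y <= #|U|%:R.
Proof.
move=> y0 x0 class dn noS noD.
have joined (A B : {set 'I_n}) : [disjoint A & B] -> x <= #|A|%:R -> x <= #|B|%:R ->
    exists a b, [/\ a \in A, b \in B & [set a; b] \in edges G].
  move=> AB Ax Bx; apply: contra_notP noS => nAB.
  exists (A, B) => /=; first by rewrite AB Ax.
  move=> [a b]; rewrite inE /= => /andP[aA bB]; apply/negP => abG.
  by apply: nAB; exists a, b.
have nomedium (D : {set 'I_n}) : y < #|D|%:R -> #|D|%:R <= y + 2 * x ->
    ~~ color_closed G c D.
  by move=> yD Dx; apply/negP => Dcl; apply: noD; exists D => //; rewrite (ltW yD).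
have [D [Dy conn]] := exists_color_connected y0 class joined nomedium.
have DC : (#|D| + #|~: D| = n)%N by rewrite cardsC card_ord.
have DR : #|D|%:R + #|~: D|%:R = n%:R :> R by rewrite -natrD DC.
have rig : rigid R d (Defs.induced G (~: D)).
  apply: color_connected_rigid conn _ => [j|].
    (* A colour class has more than [y] vertices, so every colour survives the removal of [D]. *)
    have /subsetPn[v vj vD] : ~~ ([set v | c v == j] \subset D).
      apply/negP => /subset_leq_card; rewrite -(ler_nat R) leNgt => /negP; apply.
      by have := class j; lra.
    have vD' : v \in ~: D by rewrite inE.
    by exists (Sub v vD'); move: vj; rewrite inE => /eqP.
  by rewrite card_sig -(ltr_nat R) [X in _ < X%:R](eq_card (B := ~: D)) //; lra.
have [U [Ucomp UD]] := rigid_sub_component rig.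
exists U; split=> //; apply: (@le_trans _ _ #|~: D|%:R); last by rewrite ler_nat.
by lra.
Qed.

Lemma Gnp_prob_rigid_component (R : realType) (eps C : R) (n d : nat) :
  let be : R := (16 * d%:R)^-1 in let dl : R := eps / (8 * d%:R) in
  let p := C * d%:R * ln d%:R / n%:R in
  0 < eps -> eps < 1 -> (2 <= d)%N -> 32 <= C ->
  expR (- (C / 32 * ln d%:R)) <= eps / (16 * expR 2 * d%:R) ->
  (2 * d <= n)%N -> C * d%:R * ln d%:R <= n%:R ->
  1 - expR (- be) ^+ n - expR (- dl) ^+ n <=
  Gnp_prob p (fun G : sgraph 'I_n =>
    exists U : {set 'I_n}, rigid_component R d G U /\ (1 - eps) * n%:R <= #|U|%:R) <= 1.
Proof.
move=> be dl p e0 e1 d2 C32 decay n2d nC.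
have d0 : (0 < d)%N by lia.
have dR : 2 <= d%:R :> R by rewrite ler_nat.
have dR0 : 0 < d%:R :> R by rewrite ltr0n.
have ld0 : 0 <= ln d%:R :> R by rewrite ln_ge0 // ler1n.
have be0 : 0 < be by rewrite invr_gt0 mulr_gt0.
have dl0 : 0 < dl by rewrite divr_gt0 ?mulr_gt0.
have dl_eps : dl <= eps / 16 by rewrite ler_pM2l // lef_pV2 ?posrE ?mulr_gt0 //; lra.
have n0 : 0 < n%:R :> R by rewrite ltr0n; lia.
have n2dR : 2 * d%:R <= n%:R :> R by rewrite -natrM ler_nat.
have pn : p * n%:R = C * d%:R * ln d%:R by rewrite divfK ?gt_eqF.
have p01 : 0 <= p <= 1.
  rewrite ler_pdivrMr // mul1r nC andbT divr_ge0 ?mulr_ge0 //; lra.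
rewrite Gnp_prob_le1 // andbT.
pose c (v : 'I_n) := Ordinal (ltn_pmod v d0).
have class j : n%:R / (2 * d%:R) <= #|[set v | c v == j]|%:R :> R.
  rewrite ler_pdivrMr ?mulr_gt0 // -!natrM ler_nat [(#|_| * _)%N]mulnC.
  exact: card_residue_class.
pose x := be * n%:R; pose y := dl * n%:R.
have x0 : 0 < x by rewrite mulr_gt0.
have y0 : 0 < y by rewrite mulr_gt0.
have xE : n%:R / (2 * d%:R) = 8 * x by rewrite /x /be; field; rewrite gt_eqF.
have xE' : n%:R / (4 * d%:R) = 4 * x by rewrite /x /be; field; rewrite gt_eqF.
(* Hence [y + 2 * x <= 4 * x]: of the [8 * x] vertices guaranteed in each class, [4 * x] remain
   outside a medium set. *)
have yx : y <= 2 * x.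
  have -> : y = eps * (2 * x) by rewrite /x /y /be /dl; field; rewrite gt_eqF.
  by rewrite ler_piMl ?mulr_ge0 // ltW.
have E0 := expR_gt0 (2 : R).
have E_decay : expR 2 * expR (- (C / 32 * ln d%:R)) <= eps / (16 * d%:R).
  apply: le_trans (ler_wpM2l (ltW E0) decay) _; rewrite le_eqVlt; apply/orP; left.
  by apply/eqP; field; rewrite !gt_eqF.
apply: le_trans (Gnp_prob_ge p01 (B := @unjoined_pair R _ x)
  (C := medium_closed c y (y + 2 * x)) _); last first.
- move=> G noS noD.
  have dny : d%:R + y < n%:R.
    have : y <= n%:R / 16.
      rewrite /y mulrC; apply: ler_wpM2l; [exact: ltW | lra].
    by lra.
  have class' j : y + 2 * x <= #|[set v | c v == j]|%:R :> R.
    by apply: le_trans (class j); rewrite xE; lra.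
  have [U [Ucomp Uy]] := rigid_of_pseudorandom (ltW y0) x0 class' dny noS noD.
  exists U; split => //; apply: le_trans Uy.
  rewrite mulrBl mul1r lerD2l lerN2; apply: ler_wpM2r; [exact: ltW | lra].
- apply: lerB; first apply: lerB => //.
    apply: (Gnp_prob_unjoined p01 (ltW be0)).
    have -> : p * (be * n%:R) / 2 = C / 32 * ln d%:R.
      by rewrite mulrCA pn /be; field; rewrite gt_eqF.
    apply: le_trans E_decay _.
    rewrite /be -[leRHS]mul1r; apply: ler_wpM2r; last exact: ltW.
    by rewrite invr_ge0 mulr_ge0.
  apply: (Gnp_prob_medium_closed p01 d0 (m := n%:R / (4 * d%:R))) => [j|].
    by apply: le_trans (class j); rewrite xE xE'; lra.
  have -> : p * (n%:R / (4 * d%:R)) = C / 4 * ln d%:R.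
    by rewrite mulrA pn; field; rewrite gt_eqF.
  (* As [C >= 32], the gap between [C / 4] and [C / 32] exceeds one and pays for the factor [d] from
     the colour choices. *)
  have decay2 : expR (- (C / 4 * ln d%:R)) <= expR (- (C / 32 * ln d%:R)) / d%:R.
    rewrite -[X in _ <= _ / X]lnK ?posrE // -expRN -expRD ler_expR.
    by nra.
  apply: (@le_trans _ _ (expR 2 * expR (- (C / 32 * ln d%:R)))).
    by rewrite ler_pM2l // mulrC -ler_pdivlMr.
  apply: le_trans E_decay _; rewrite /dl; apply: ler_wpM2l; first exact: ltW.
  by rewrite lef_pV2 ?posrE ?mulr_gt0 // ler_wpM2r // ?ltW // ltr_nat.
Qed.

Local Open Scope classical_set_scope.
Local Open Scope ring_scope.

Theorem theorem1p13 (R : realType) (eps : R) (eps_gt0 : 0 < eps) (eps_lt1 : eps < 1) :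
  exists C : R, 0 < C /\
    forall d : nat, (2 <= d)%N ->
      (fun n : nat =>
         Gnp_prob (C * d%:R * ln d%:R / n%:R)
           (fun G : sgraph 'I_n =>
              exists U : {set 'I_n},
                rigid_component R d G U /\ (1 - eps) * n%:R <= #|U|%:R))
        @ \oo --> (1 : R).
Proof.
pose L : R := 1 + ln (16 * expR 2 / eps) / ln 2.
have E1 : 1 <= expR 2 :> R by rewrite -[leLHS]expR0 ler_expR.
have L1 : 1 <= L.
  rewrite lerDl divr_ge0 ?ln_ge0 ?ler1n // ler_pdivlMr // mul1r; lra.
(* The exponent [C / 32] is then exactly the [L] of the decay estimate, and [1 <= L] gives
   [32 <= C]. *)
exists (32 * L); split=> [|d d2]; first by lra.
have decay := expR_log_decay eps_gt0 eps_lt1 d2; rewrite -/L in decay.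
have dR0 : 0 < d%:R :> R by rewrite ltr0n; lia.
have vanish (a : R) : 0 < a -> (fun n : nat => expR (- a) ^+ n) @ \oo --> (0 : R).
  move=> a0; apply: cvg_expr.
  by rewrite ger0_norm ?expR_ge0 // -[ltRHS]expR0 ltr_expR oppr_lt0.
pose be : R := (16 * d%:R)^-1; pose dl : R := eps / (8 * d%:R).
apply: (@squeeze_cvgr _ _ _ _ (fun n : nat => 1 - expR (- be) ^+ n - expR (- dl) ^+ n)
  (cst 1)); [| |exact: cvg_cst].
  (* Large [n] ensures [2 * d <= n] and an edge probability of at most one. *)
  near=> n; apply: Gnp_prob_rigid_component => //.
  - lra.
  - by rewrite [32 * L]mulrC mulfK.
  - by near: n; exact: nbhs_infty_ge.
  - by near: n; exact: nbhs_infty_ger.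
rewrite -[X in _ --> X]subr0 -[X in _ --> X - _]subr0.
apply: cvgB; last by apply: vanish; rewrite divr_gt0 ?mulr_gt0.
apply: cvgB; first exact: cvg_cst.
by apply: vanish; rewrite invr_gt0 mulr_gt0.
Unshelve. all: by end_near.
Qed.
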